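(* Let $n\ge 1$. For every parking function $f\in \mathrm{PF}_n$, $$\mathrm{dinv}(f)=\mathrm{area}(\phi_n(f)).$$
   Context: Let $n\geq 1$ and $[n]=\{1,\dots,n\}$. A parking function of size $n$ is a function $f:[n]\to[n]$ with $|f^{-1}(\{1,\dots,m\})|\ge m$ for all $m\in[n]$; $\mathrm{PF}_n$ is the set of these. Elements of $[n]$ are called labels. A parking function is identified with a labelled Dyck path from $(0,0)$ to $(n,n)$ (north and east unit steps, never below the diagonal $y=x$): the north steps on the line $x=i-1$ carry the labels in $f^{-1}(i)$, increasing from bottom to top. So label $\lambda$ lies in column $f(\lambda)$, and the rows, numbered $1,\dots,n$ from bottom to top, each contain exactly one label (the labels ordered by increasing $f(\lambda)$, ties broken by increasing $\lambda$). Area: $a_\lambda(f)$ is the number of whole unit squares between the path and the main diagonal $y=x$ in the row containing $\lambda$; if $\lambda$ is in row $i$, then $a_\lambda(f)=i-f(\lambda)$. $\mathrm{area}(f)=\sum_{\lambda\in[n]}a_\lambda(f)$. Dinv: $\mathrm{Dinv}(f)$ is the set of pairs $\{\lambda,\mu\}\subseteq[n]$ with $\lambda<\mu$ such that either (A) $f(\lambda)<f(\mu)$ and $a_\lambda(f)=a_\mu(f)$, or (B) $f(\lambda)>f(\mu)$ and $a_\lambda(f)+1=a_\mu(f)$. $\mathrm{dinv}(f)=\#\mathrm{Dinv}(f)$. The map $\phi_n$: the dinv reading word of $f$ is the word $w_1w_2\cdots w_n$ listing all labels in increasing order with respect to the total order in which $\lambda$ precedes $\mu$ iff $a_\lambda(f)<a_\mu(f)$,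 or $a_\lambda(f)=a_\mu(f)$ and $f(\lambda)<f(\mu)$. For $\lambda=w_j$ set $d_\lambda(f)=\#\{\{w_i,w_j\}\in\mathrm{Dinv}(f) : i<j\}$. Then $\phi_n:\mathrm{PF}_n\to\mathrm{PF}_n$ is defined by $(\phi_n(f))(w_i)=i-d_{w_i}(f)$ for all $i\in[n]$ (this is indeed a parking function). *)

(* Defs.v *)
From mathcomp Require Import all_boot.

Set Implicit Arguments.
Unset Strict Implicit.
Unset Printing Implicit Defensive.

(* Everything in [n] (labels, columns, rows, reading positions) is shifted down
   by one and lives in 'I_n = {0, ..., n-1}; differences and comparisons
   of such quantities are unaffected. *)

(* m here stands for the bound m + 1 in [n], so that f^{-1}({1, ..., m + 1})
   becomes [set l | f l <= m]. *)
Definition parking (n : nat) (f : {ffun 'I_n -> 'I_n}) : bool :=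
  [forall m : 'I_n, m.+1 <= #|[set l | f l <= m]|].

Record PF (n : nat) := ParkingFunction {
  pf_fun :> {ffun 'I_n -> 'I_n};
  pf_parking : parking pf_fun
}.

Section Statistics.
Variables (n : nat) (f : PF n).
Implicit Types l k : 'I_n.

Definition below k l : bool := (f k < f l) || (f k == f l) && (k < l).

Definition row l : nat := #|[set k | below k l]|.

(* The subtraction is never truncated: see leq_col_row. *)
Definition area_at l : nat := row l - f l.

Definition area : nat := \sum_l area_at l.

Definition attack l k : bool :=
  (f l < f k) && (area_at l == area_at k)
  || (f k < f l) && ((area_at l).+1 == area_at k).

Definition Dinv : {set {set 'I_n}} :=
  [set [set p.1; p.2] | p : 'I_n * 'I_n & (p.1 < p.2) && attack p.1 p.2].

Definition dinv : nat := #|Dinv|.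

Definition precedes l k : bool :=
  (area_at l < area_at k) || (area_at l == area_at k) && (f l < f k).

Definition reading_word : n.-tuple 'I_n :=
  [tuple of sort [rel l k | (l == k) || precedes l k] (ord_tuple n)].

Definition position l : nat := index l reading_word.

Definition dinv_at l : nat :=
  #|[set k | (position k < position l) && ([set k; l] \in Dinv)]|.

Lemma mem_reading_word l : l \in reading_word.
Proof. by rewrite mem_sort val_ord_tuple mem_enum. Qed.

Lemma uniq_reading_word : uniq reading_word.
Proof. by rewrite sort_uniq val_ord_tuple enum_uniq. Qed.

Lemma position_lt l : position l < n.
Proof. by rewrite -[X in _ < X](size_tuple reading_word) index_mem mem_reading_word. Qed.

Lemma position_tnth (i : 'I_n) : position (tnth reading_word i) = i.
Proof.
by rewrite /position (tnth_nth i) index_uniq ?size_tuple ?uniq_reading_word.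
Qed.

Lemma phi_subproof l : position l - dinv_at l < n.
Proof. exact: leq_ltn_trans (leq_subr _ _) (position_lt l). Qed.

(* If l = w_(i+1) then position l = i and the value is (i + 1 - d_l) - 1;
   the subtraction is never truncated: see dinv_at_le. *)
Definition phi_fun : {ffun 'I_n -> 'I_n} :=
  [ffun l => Ordinal (phi_subproof l)].

Lemma phi_parking : parking phi_fun.
Proof.
apply/forallP => m; set A := [set _ | _].
pose g (i : 'I_m.+1) := tnth reading_word (widen_ord (ltn_ord m) i).
have g_inj : injective g.
  move=> i j /(congr1 position); rewrite !position_tnth /= => ij.
  exact: val_inj.
rewrite -[X in X <= _]card_ord -(card_imset predT g_inj).
apply/subset_leq_card/subsetP => _ /imsetP[i _ ->].
rewrite inE ffunE /= position_tnth /=.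
by apply: leq_trans (leq_subr _ _) _; rewrite -ltnS.
Qed.

Lemma dinv_at_le l : dinv_at l <= position l.
Proof.
rewrite -[X in _ <= X]card_ord.
pose h (i : 'I_(position l)) :=
  tnth reading_word (widen_ord (ltnW (position_lt l)) i).
apply: leq_trans (leq_imset_card h predT).
apply/subset_leq_card/subsetP => k; rewrite inE => /andP[kl _].
apply/imsetP; exists (Ordinal kl) => //.
by rewrite /h (tnth_nth k) /= nth_index ?mem_reading_word.
Qed.

Lemma leq_col_row l : f l <= row l.
Proof.
case fl: (nat_of_ord (f l)) => [//|c].
have cn : c < n by apply: ltnW; rewrite -fl ltn_ord.
have /forallP/(_ (Ordinal cn)) /= := pf_parking f.
move=> /leq_trans; apply; apply/subset_leq_card/subsetP => k.
by rewrite !inE /below fl ltnS => ->.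
Qed.

Lemma row_inj : injective row.
Proof.
have lt l k : below l k -> row l < row k.
  move=> lk; apply/proper_card/properP; split.
    apply/subsetP => j; rewrite !inE /below in lk *.
    case/orP: lk => [lk|/andP[/eqP<- lk]].
      by case/orP=> [/ltn_trans->//|/andP[/eqP-> _]]; rewrite ?lk.
    by case/orP=> [->//|/andP[-> /ltn_trans->]//]; rewrite orbT.
  by exists l; rewrite !inE // /below !ltnn andbF.
move=> l k e; apply/eqP/contraT => ne.
have : below l k || below k l.
  rewrite /below -!val_eqE /=; case: ltngtP => //= _.
  by rewrite -neq_ltn val_eqE.
by case/orP=> /lt; rewrite e ltnn.
Qed.

(* On a parking function, precedes is indeed a strict total order. *)
Lemma precedes_total l k : l != k -> precedes l k || precedes k l.
Proof.
rewrite /precedes [area_at k == _]eq_sym => ne; case: ltngtP => //= e.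
rewrite -neq_ltn; apply: contra ne => /eqP ff; apply/eqP/row_inj.
by rewrite -(subnK (leq_col_row l)) -(subnK (leq_col_row k)) -/(area_at l) e ff.
Qed.

Lemma precedes_trans l k j : precedes l k -> precedes k j -> precedes l j.
Proof.
rewrite /precedes => /orP[lk|/andP[/eqP-> lk]].
  by case/orP=> [/(ltn_trans lk)->//|/andP[/eqP<- _]]; rewrite lk.
by case/orP=> [->//|/andP[-> /(ltn_trans lk)->]]; rewrite orbT.
Qed.

Lemma position_ltE l k : (position l < position k) = precedes l k.
Proof.
have irr j : precedes j j = false by rewrite /precedes !ltnn andbF.
pose r := [rel l k | (l == k) || precedes l k].
have tot : total r.
  move=> x y; rewrite /= [y == x]eq_sym.
  by case: eqVneq => //= /precedes_total.
have tr : transitive r.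
  move=> y x z /= /orP[/eqP->//|xy] /orP[/eqP<-|yz]; first by rewrite xy orbT.
  by rewrite (precedes_trans xy yz) orbT.
have sub x y : position x < position y -> precedes x y.
  move=> xy; have := sorted_leq_nth tr _ x (sort_sorted tot (enum 'I_n)).
  have rr : reflexive r by move=> z /=; rewrite eqxx.
  move/(_ rr (position x) (position y)).
  rewrite !inE -/(tval reading_word) -[sort r _]/(tval reading_word).
  rewrite !size_tuple !position_lt => /(_ isT isT (ltnW xy)) /=.
  rewrite !nth_index ?mem_reading_word // => /orP[/eqP e|//].
  by rewrite e ltnn in xy.
apply/idP/idP => [/sub//|lk]; rewrite ltnNge; apply/negP.
rewrite leq_eqVlt => /orP[/eqP e|/sub /(precedes_trans lk)]; last by rewrite irr.
move: lk; rewrite -(nth_index l (mem_reading_word l)) -/(position l) -e.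
by rewrite nth_index ?mem_reading_word // irr.
Qed.

End Statistics.

Definition phi (n : nat) (f : PF n) : PF n := ParkingFunction (phi_parking f).

(* Main.v *)
(* Both the rows of phi f and the reading positions of f run over
   {0, ..., n-1}, so in area (phi f) = sum_l (row l - (position l - d_l)) they
   cancel, leaving sum_l d_l; this counts each pair of Dinv f once, at its later
   label in reading order. *)
Require Import Defs.
From mathcomp Require Import all_boot.

Lemma row_lt (n : nat) (f : PF n) (l : 'I_n) : row f l < n.
Proof.
rewrite /row -[X in _ < X]card_ord; apply/proper_card/properP.
split; first exact: subset_predT.
by exists l; rewrite // inE /below !ltnn andbF.
Qed.

(** An injection of a finite set into one of the same size is a bijection, so the sum can be
    reindexed. *)
Lemma sum_inj_ord (n : nat) (F : 'I_n -> nat) (F_lt : forall l, F l < n) :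
  injective F -> \sum_l F l = \sum_(i < n) i.
Proof.
move=> F_inj; pose h l := Ordinal (F_lt l).
have h_inj : injective h by move=> l k /(congr1 val) /F_inj.
by rewrite [RHS](reindex_inj h_inj).
Qed.

Lemma position_inj (n : nat) (f : PF n) : injective (position f).
Proof.
move=> l k; rewrite /position => e.
by rewrite -(nth_index l (mem_reading_word f l)) e nth_index ?mem_reading_word.
Qed.

Lemma area_phi (n : nat) (f : PF n) : area (phi f) = \sum_l dinv_at f l.
Proof.
rewrite /area sumnB => [|l _]; last exact: leq_col_row.
rewrite (sum_inj_ord _ _ (row_lt _ (phi f))); last exact: row_inj.
(* The sum of rows is traded for the sum of positions, leaving a difference of the form
   [a - (a - b)]. *)
rewrite -(sum_inj_ord _ _ (position_lt f) (position_inj _ f)).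
under [X in _ - X]eq_bigr => l _ do rewrite ffunE /=.
rewrite sumnB => [|l _]; last exact: dinv_at_le.
by rewrite subKn // leq_sum // => l _; exact: dinv_at_le.
Qed.

Lemma dinv_sum (n : nat) (f : PF n) : dinv f = \sum_l dinv_at f l.
Proof.
(* Each pair is oriented with its later label in reading order first, so the fibre of [D] over [l]
   has [dinv_at f l] elements. *)
pose D := [set p : 'I_n * 'I_n | (position f p.2 < position f p.1)
                               && ([set p.2; p.1] \in Dinv f)].
transitivity #|D|; last first.
  rewrite -sum1_card (eq_bigl _ _ (in_set _)).
  rewrite -(pair_big_dep xpredT
    (fun l k => (position f k < position f l) && ([set k; l] \in Dinv f))
    (fun _ _ => 1)) /=.
  apply: eq_bigr => l _; rewrite /dinv_at -sum1_card.
  by apply: eq_bigl => k; rewrite inE.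
rewrite -(card_in_imset (f := fun p : 'I_n * 'I_n => [set p.2; p.1]) (D := D)).
  apply: eq_card => S; apply/idP/imsetP => [SD|[p]]; last first.
    by rewrite inE => /andP[_ ?] ->.
  have [[l k]] := imsetP SD; rewrite inE /= => /andP[lk _] eS.
  have : position f l != position f k.
    by rewrite (inj_eq (position_inj _ f)) neq_ltn lk.
  (* [l < k] compares labels, not positions, so either orientation may be the one in [D]. *)
  rewrite neq_ltn => /orP[] lt; [exists (k, l) | exists (l, k)] => //=.
  - by rewrite inE /= lt -eS.
  - by rewrite inE /= lt setUC -eS.
  - by rewrite setUC.
move=> [l k] [l' k']; rewrite !inE /= => /andP[kl _] /andP[kl' _] e.
(* Positions recover the orientation: a swap would reverse a strict inequality, and the two
   degenerate matchings force [k = l]. *)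
have := set21 k l; rewrite e !inE => /orP[] /eqP ek;
have := set22 k l; rewrite e !inE => /orP[] /eqP el; subst => //.
- by rewrite ltnn in kl.
- by have := ltn_trans kl kl'; rewrite ltnn.
- by rewrite ltnn in kl.
Qed.

Theorem proposition3p3 (n : nat) (hn : 1 <= n) (f : PF n) :
  dinv f = area (phi f).
Proof. by rewrite dinv_sum area_phi. Qed.
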